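(* The model checking problem for $H_\mu$ — given a finite Kripke structure $\mathcal{K}$ and a closed $H_\mu$ formula $\varphi$, decide whether $\mathcal{K}\models\varphi$ — is $\Sigma^1_2$-hard.
   Context: Let $\mathrm{AP}$ be a finite set of atomic propositions. A Kripke structure is $\mathcal{K}=(S,s_0,\delta,L)$ with finite $S$, initial $s_0$, total $\delta\subseteq S\times S$ and $L:S\to2^{\mathrm{AP}}$; $\mathrm{Paths}(\mathcal{K})$ is the set of infinite $\delta$-paths from $s_0$. $H_\mu$ formulas: $\varphi::=\exists\pi.\varphi\mid\forall\pi.\varphi\mid\psi$, $\psi::=a_\pi\mid X\mid\bigcirc_\pi\psi\mid\psi\vee\psi\mid\neg\psi\mid\mu X.\psi$, with $X$ occurring in $\mu X.\psi$ only under an even number of negations; closed means all path variables and predicates are bound. For quantifier-free $\psi$ over $\pi_1,\dots,\pi_n$, a path assignment $\Pi$ maps $\pi_i$ to paths, a predicate valuation $\mathcal{V}$ maps predicates to functions from path assignments to subsets of $\mathbb{N}_0^n$; $[\![a_{\pi_i}]\!]^{\mathcal{V}}(\Pi)=\{j\in\mathbb{N}_0^n:a\in L(\Pi(\pi_i)(j_i))\}$, $[\![X]\!]^{\mathcal{V}}=\mathcal{V}(X)$, $[\![\bigcirc_{\pi_i}\psi]\!]^{\mathcal{V}}(\Pi)=\{j: j+e_i\in[\![\psi]\!]^{\mathcal{V}}(\Pi)\}$, $\vee$ is union, $\neg$ is complement in $\mathbb{N}_0^n$, $[\![\mu X.\psi]\!]^{\mathcal{V}}$ is the least fixpoint of $\xi\mapsto[\![\psi]\!]^{\mathcal{V}[X\mapsto\xi]}$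 w.r.t. pointwise inclusion. $\Pi\models\exists\pi.\varphi$ iff $\Pi[\pi\mapsto p]\models\varphi$ for some $p\in\mathrm{Paths}(\mathcal{K})$; $\forall$ dually; $\Pi\models\psi$ iff $(0,\dots,0)\in[\![\psi]\!]^{\mathcal{V}}(\Pi)$ for some $\mathcal{V}$; $\mathcal{K}\models\varphi$ iff the empty assignment satisfies $\varphi$. A decision problem (set of codes $A\subseteq\mathbb{N}$) is $\Sigma^1_2$-hard if every $\Sigma^1_2$ set of natural numbers (definable in second-order arithmetic by $\exists X_1\dots\exists X_k\psi$ with $\psi\in\Pi^1_1$) is 1-reducible to it (via a total computable injective function). *)

(* Defs.v *)
From mathcomp Require Import all_boot.
From mathcomp Require Import boolp classical_sets.

Set Implicit Arguments.
Unset Strict Implicit.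
Unset Printing Implicit Defensive.

Local Open Scope classical_set_scope.

(** * Kripke structures and paths *)

Record kripke (AP S : finType) := Kripke {
  init : S;
  trans : {set S * S};
  label : {ffun S -> {set AP}};
  trans_total : [forall s, exists t, (s, t) \in trans]
}.

Record path_of (AP S : finType) (K : kripke AP S) := Path {
  pos :> nat -> S;
  pos_init : pos 0 = init K;
  pos_trans : forall i, (pos i, pos i.+1) \in trans K
}.

(** * Syntax of H_mu *)

(* [qf AP n] is the type of quantifier-free formulas over the path variables
   pi_0, ..., pi_(n-1); fixpoint predicates are named by natural numbers. *)
Inductive qf (AP : Type) (n : nat) : Type :=
| Atom of AP & 'I_n
| Pred of nat
| Next of 'I_n & qf AP n
| Or of qf AP n & qf AP n
| Neg of qf AP n
| Mu of nat & qf AP n.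

Arguments Pred {AP n} _.

(* [hform AP n] is the type of formulas whose free path variables are among
   pi_0, ..., pi_(n-1).  The path quantifiers of [hform AP n] bind pi_n (de
   Bruijn levels), so [hform AP 0] has no free path variable. *)
Inductive hform (AP : Type) (n : nat) : Type :=
| HExists of hform AP n.+1
| HForall of hform AP n.+1
| HBody of qf AP n.

Section Syntax.
Variable AP : Type.

(* Every free occurrence of X in psi is under an even (b = true), resp. odd
   (b = false), number of negations. *)
Fixpoint polarity n (b : bool) (X : nat) (psi : qf AP n) : bool :=
  match psi with
  | Atom _ _ => true
  | Pred Y => (Y == X) ==> b
  | Next _ psi1 => polarity b X psi1
  | Or psi1 psi2 => polarity b X psi1 && polarity b X psi2
  | Neg psi1 => polarity (~~ b) X psi1
  | Mu Y psi1 => (Y == X) || polarity b X psi1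
  end.

Fixpoint qf_wf n (psi : qf AP n) : bool :=
  match psi with
  | Atom _ _ | Pred _ => true
  | Next _ psi1 | Neg psi1 => qf_wf psi1
  | Or psi1 psi2 => qf_wf psi1 && qf_wf psi2
  | Mu X psi1 => polarity true X psi1 && qf_wf psi1
  end.

(* The free predicates of psi are among Xs. *)
Fixpoint qf_preds_in n (Xs : seq nat) (psi : qf AP n) : bool :=
  match psi with
  | Atom _ _ => true
  | Pred X => X \in Xs
  | Next _ psi1 | Neg psi1 => qf_preds_in Xs psi1
  | Or psi1 psi2 => qf_preds_in Xs psi1 && qf_preds_in Xs psi2
  | Mu X psi1 => qf_preds_in (X :: Xs) psi1
  end.

Fixpoint hform_wf n (phi : hform AP n) : bool :=
  match phi with
  | HExists phi1 | HForall phi1 => hform_wf phi1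
  | HBody psi => qf_wf psi
  end.

Fixpoint hform_preds_bound n (phi : hform AP n) : bool :=
  match phi with
  | HExists phi1 | HForall phi1 => hform_preds_bound phi1
  | HBody psi => qf_preds_in [::] psi
  end.

End Syntax.

(** * Semantics of H_mu *)

Section Semantics.
Variables (AP S : finType) (K : kripke AP S).

Definition assignment n := {ffun 'I_n -> path_of K}.

Definition extend n (Pi : assignment n) (p : path_of K) : assignment n.+1 :=
  [ffun i => oapp Pi p (unlift ord_max i)].

Definition index n := {ffun 'I_n -> nat}.

Definition shift n (j : index n) (i : 'I_n) : index n :=
  [ffun k => j k + (k == i)].

Definition predicate n := assignment n -> set (index n).

Definition valuation n := nat -> predicate n.

Definition update n (V : valuation n) (X : nat) (xi : predicate n)
  : valuation n := fun Y => if Y == X then xi else V Y.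

Definition pred_le n (xi xi' : predicate n) := forall Pi, xi Pi `<=` xi' Pi.

(* Knaster-Tarski: the intersection of all prefixed points.  See
   [qf_sem_Mu_least_fixpoint] below. *)
Definition lfp n (F : predicate n -> predicate n) : predicate n :=
  fun Pi => \bigcap_(xi in [set xi | pred_le (F xi) xi]) xi Pi.

Fixpoint qf_sem n (V : valuation n) (psi : qf AP n) : predicate n :=
  match psi with
  | Atom a i => fun Pi => [set j | a \in label K (Pi i (j i))]
  | Pred X => V X
  | Next i psi1 => fun Pi => [set j | qf_sem V psi1 Pi (shift j i)]
  | Or psi1 psi2 => fun Pi => qf_sem V psi1 Pi `|` qf_sem V psi2 Pi
  | Neg psi1 => fun Pi => ~` qf_sem V psi1 Pi
  | Mu X psi1 => lfp (fun xi => qf_sem (update V X xi) psi1)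
  end.

Fixpoint hform_sat n (phi : hform AP n) : assignment n -> Prop :=
  match phi with
  | HExists phi1 => fun Pi => exists p, hform_sat phi1 (extend Pi p)
  | HForall phi1 => fun Pi => forall p, hform_sat phi1 (extend Pi p)
  | HBody psi => fun Pi => exists V, qf_sem V psi Pi [ffun=> 0]
  end.

Definition models (phi : hform AP 0) : Prop :=
  hform_sat phi (ffun0 (card_ord 0)).

Lemma update_id n (V : valuation n) X xi xi' :
  update (update V X xi) X xi' = update V X xi'.
Proof. by apply/funext => Y; rewrite /update; case: eqP. Qed.

Lemma updateC n (V : valuation n) X Y xi xi' : X != Y ->
  update (update V X xi) Y xi' = update (update V Y xi') X xi.
Proof.
move=> XY; apply/funext => Z; rewrite /update.
by case: (eqVneq Z Y) => // ->; rewrite eq_sym (negPf XY).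
Qed.

Lemma qf_sem_monotone n b (psi : qf AP n) V X xi xi' :
  polarity b X psi -> pred_le xi xi' ->
  if b then pred_le (qf_sem (update V X xi) psi) (qf_sem (update V X xi') psi)
  else pred_le (qf_sem (update V X xi') psi) (qf_sem (update V X xi) psi).
Proof.
elim: psi b V xi xi' => [a i|Y|i psi IH|psi1 IH1 psi2 IH2|psi IH|Y psi IH]
  b V xi xi' /=.
- by case: b => _ _ Pi j.
- by rewrite /update; case: eqP => _ /=; case: b => // _ _ Pi j.
- by move=> /IH{}IH /(IH V); case: b {IH} => H Pi j; apply: H.
- case/andP=> /IH1{}IH1 /IH2{}IH2 le; move: (IH1 V _ _ le) (IH2 V _ _ le).
  by case: b {IH1 IH2} => H1 H2 Pi j [/H1|/H2]; [left|right|left|right].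
- by move=> /IH{}IH /(IH V); case: b {IH} => /= H Pi j nj /H.
- have [->|YX] := eqVneq Y X => /=.
    move=> _ _.
    have E xi1 : lfp (fun xi0 => qf_sem (update (update V X xi1) X xi0) psi)
        = lfp (fun xi0 => qf_sem (update V X xi0) psi).
      by congr lfp; apply/funext => xi0; rewrite update_id.
    by rewrite !E; case: b => Pi j.
  move=> /IH{}IH le.
  have lfp_le F G : (forall xi0 : predicate n, pred_le (F xi0) (G xi0)) ->
      pred_le (lfp F) (lfp G).
    by move=> FG Pi j Fj xi0 /= Gxi0; apply: Fj => Pi' j' /FG /Gxi0.
  by case: b IH => IH; apply: lfp_le => xi0;
    rewrite ![update (update V X _) Y _]updateC 1?eq_sym //; apply: IH.
Qed.

Lemma qf_sem_Mu_least_fixpoint n (V : valuation n) X (psi : qf AP n) :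
  qf_wf (Mu X psi) ->
  let F xi := qf_sem (update V X xi) psi in
  F (qf_sem V (Mu X psi)) = qf_sem V (Mu X psi) /\
  forall xi, F xi = xi -> pred_le (qf_sem V (Mu X psi)) xi.
Proof.
move=> /= /andP[psiX _].
set F := fun xi => qf_sem (update V X xi) psi.
have monoF xi xi' : pred_le xi xi' -> pred_le (F xi) (F xi').
  exact: (@qf_sem_monotone n true).
have lfpP xi : pred_le (F xi) xi -> pred_le (lfp F) xi.
  by move=> Fxi Pi j; apply.
have pre : pred_le (F (lfp F)) (lfp F).
  by move=> Pi j Fj xi /= Fxi; apply/Fxi/(monoF _ _ (lfpP _ Fxi)).
split; last by move=> xi Fxi; apply: lfpP; rewrite /F Fxi => Pi j.
by apply/funext => Pi; apply/seteqP; split; [exact: pre|exact: (lfpP _ (monoF _ _ pre))].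
Qed.

End Semantics.

(** * The model checking problem as a set of natural numbers *)

(* Instances are coded with the bijection [CodeSeq.code : seq nat -> nat].
   States and atomic propositions are numbered; the (finite) number of atomic
   propositions is part of the instance. *)
Definition code_kripke k m (K : kripke 'I_k 'I_m) : nat :=
  CodeSeq.code
    [:: k; m; init K : nat;
        CodeSeq.code [seq (((s, t) \in trans K) : nat) | s <- enum 'I_m,
                                                         t <- enum 'I_m];
        CodeSeq.code [seq ((a \in label K s) : nat) | s <- enum 'I_m,
                                                      a <- enum 'I_k]].

Fixpoint code_qf k n (psi : qf 'I_k n) : nat :=
  match psi with
  | Atom a i => CodeSeq.code [:: 0; a : nat; i : nat]
  | Pred X => CodeSeq.code [:: 1; X]
  | Next i psi1 => CodeSeq.code [:: 2; i : nat; code_qf psi1]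
  | Or psi1 psi2 => CodeSeq.code [:: 3; code_qf psi1; code_qf psi2]
  | Neg psi1 => CodeSeq.code [:: 4; code_qf psi1]
  | Mu X psi1 => CodeSeq.code [:: 5; X; code_qf psi1]
  end.

Fixpoint code_hform k n (phi : hform 'I_k n) : nat :=
  match phi with
  | HExists phi1 => CodeSeq.code [:: 0; code_hform phi1]
  | HForall phi1 => CodeSeq.code [:: 1; code_hform phi1]
  | HBody psi => CodeSeq.code [:: 2; code_qf psi]
  end.

Definition code_instance k m (K : kripke 'I_k 'I_m) (phi : hform 'I_k 0) :=
  CodeSeq.code [:: code_kripke K; code_hform phi].

Definition model_checking : set nat :=
  [set c | exists k m (K : kripke 'I_k 'I_m) (phi : hform 'I_k 0),
    [/\ hform_wf phi, hform_preds_bound phi,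
        c = code_instance K phi & models K phi]].

Arguments CodeSeq.code : simpl never.

Lemma code_qf_inj k n : injective (@code_qf k n).
Proof.
have cI := can_inj CodeSeq.codeK.
elim=> [a i|X|i psi IH|psi1 IH1 psi2 IH2|psi IH|X psi IH]
  [a' i'|X'|i' psi'|psi1' psi2'|psi'|X' psi'] //= /cI [] //.
- by move=> /val_inj-> /val_inj->.
- by move->.
- by move=> /val_inj-> /IH->.
- by move=> /IH1-> /IH2->.
- by move=> /IH->.
- by move=> -> /IH->.
Qed.

Lemma code_hform_inj k n : injective (@code_hform k n).
Proof.
have cI := can_inj CodeSeq.codeK.
elim=> {n} [n phi IH|n phi IH|n psi] [phi'|phi'|psi'] //= /cI [] //.
- by move=> /IH->.
- by move=> /IH->.
- by move=> /code_qf_inj->.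
Qed.

Lemma code_kripke_inj k m (K K' : kripke 'I_k 'I_m) :
  code_kripke K = code_kripke K' -> K = K'.
Proof.
have cI := can_inj CodeSeq.codeK.
case: K K' => [i t l H] [i' t' l' H'] /cI /= [] /val_inj ei.
have mapE (T T' : finType) (f g : T -> T' -> bool) :
    [seq (f x y : nat) | x <- enum T, y <- enum T'] =
    [seq (g x y : nat) | x <- enum T, y <- enum T'] -> f =2 g.
  move=> E x y; have : forall s : seq T, x \in s ->
      [seq (f x y : nat) | x <- s, y <- enum T'] =
      [seq (g x y : nat) | x <- s, y <- enum T'] -> f x y = g x y.
    elim=> //= z s IH; rewrite inE => xs /eqP.
    rewrite eqseq_cat ?size_map // => /andP[/eqP E1 /eqP E2].
    case/orP: xs => [/eqP xz|xs]; last exact: IH E2.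
    rewrite -xz in E1; move/eq_in_map: E1 => /(_ y (mem_enum _ _)).
    by case: (f x y) (g x y) => [] [].
  by apply; [exact: mem_enum|exact: E].
move=> /cI /(mapE _ _ (fun s u => (s, u) \in t) (fun s u => (s, u) \in t')) et.
move=> /cI /(mapE _ _ (fun s a => a \in l s) (fun s a => a \in l' s)) el.
have {}et : t = t' by apply/setP => -[s u]; exact: et.
have {}el : l = l' by apply/ffunP => s; apply/setP => a; exact: el.
by subst; congr Kripke; exact: bool_irrelevance.
Qed.

Lemma code_instance_sizes_inj k m k' m' (K : kripke 'I_k 'I_m)
    (K' : kripke 'I_k' 'I_m') phi phi' :
  code_instance K phi = code_instance K' phi' -> k = k' /\ m = m'.
Proof. by move=> /(can_inj CodeSeq.codeK) [] /(can_inj CodeSeq.codeK) []. Qed.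

Lemma code_instance_inj k m (K K' : kripke 'I_k 'I_m) phi phi' :
  code_instance K phi = code_instance K' phi' -> K = K' /\ phi = phi'.
Proof.
by move=> /(can_inj CodeSeq.codeK) [] /code_kripke_inj-> /code_hform_inj->.
Qed.

(** * Total computable functions and 1-reducibility *)

(* The total recursive functions: minimisation is only applied to regular
   functions.  By Kleene's normal form theorem these are exactly the total
   functions among the partial recursive ones. *)
Inductive computable : forall n, (n.-tuple nat -> nat) -> Prop :=
| computable_zero n : computable (fun _ : n.-tuple nat => 0)
| computable_succ : computable (fun v : 1.-tuple nat => (thead v).+1)
| computable_proj n (i : 'I_n) : computable (fun v : n.-tuple nat => tnth v i)
| computable_comp k n (f : k.-tuple nat -> nat)
    (g : 'I_k -> n.-tuple nat -> nat) :
    computable f -> (forall i, computable (g i)) ->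
    computable (fun v => f [tuple g i v | i < k])
| computable_primrec n (f : n.-tuple nat -> nat)
    (g : n.+2.-tuple nat -> nat) :
    computable f -> computable g ->
    computable (fun v : n.+1.-tuple nat =>
      let w : n.-tuple nat := [tuple of behead v] in
      nat_rect (fun=> nat) (f w)
        (fun x r => g [tuple of x :: r :: w]) (thead v))
| computable_min n (f : n.+1.-tuple nat -> nat) (h : n.-tuple nat -> nat) :
    computable f ->
    (forall v, f [tuple of h v :: v] = 0 /\
       forall x, x < h v -> f [tuple of x :: v] <> 0) ->
    computable h
| computable_ext n (f g : n.-tuple nat -> nat) :
    f =1 g -> computable f -> computable g.

Definition computable1 (f : nat -> nat) : Prop :=
  computable (fun v : 1.-tuple nat => f (thead v)).

Definition one_reducible (A B : set nat) : Prop :=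
  exists f : nat -> nat,
    [/\ computable1 f, injective f & forall n, A n <-> B (f n)].

(** * Second-order arithmetic and the class Sigma^1_2 *)

(* Number variables and set variables are named by natural numbers, in two
   separate name spaces. *)
Inductive term : Type :=
| TVar of nat
| TZero
| TSucc of term
| TAdd of term & term
| TMul of term & term.

Inductive so_form : Type :=
| SEq of term & term
| SLt of term & term
| SMem of term & nat
| SNot of so_form
| SAnd of so_form & so_form
| SOr of so_form & so_form
| SExN of nat & so_form
| SAllN of nat & so_form
| SExS of nat & so_form
| SAllS of nat & so_form.

Definition env_update (T : Type) (e : nat -> T) (x : nat) (u : T) : nat -> T :=
  fun y => if y == x then u else e y.

Fixpoint term_eval (e : nat -> nat) (t : term) : nat :=
  match t with
  | TVar x => e x
  | TZero => 0
  | TSucc t1 => (term_eval e t1).+1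
  | TAdd t1 t2 => term_eval e t1 + term_eval e t2
  | TMul t1 t2 => term_eval e t1 * term_eval e t2
  end.

Fixpoint so_sat (e : nat -> nat) (E : nat -> set nat) (th : so_form) : Prop :=
  match th with
  | SEq t1 t2 => term_eval e t1 = term_eval e t2
  | SLt t1 t2 => term_eval e t1 < term_eval e t2
  | SMem t X => E X (term_eval e t)
  | SNot th1 => ~ so_sat e E th1
  | SAnd th1 th2 => so_sat e E th1 /\ so_sat e E th2
  | SOr th1 th2 => so_sat e E th1 \/ so_sat e E th2
  | SExN x th1 => exists u : nat, so_sat (env_update e x u) E th1
  | SAllN x th1 => forall u : nat, so_sat (env_update e x u) E th1
  | SExS X th1 => exists U : set nat, so_sat e (env_update E X U) th1
  | SAllS X th1 => forall U : set nat, so_sat e (env_update E X U) th1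
  end.

Fixpoint term_vars_in (xs : seq nat) (t : term) : bool :=
  match t with
  | TVar x => x \in xs
  | TZero => true
  | TSucc t1 => term_vars_in xs t1
  | TAdd t1 t2 | TMul t1 t2 => term_vars_in xs t1 && term_vars_in xs t2
  end.

(* The free number variables are among xs, the free set variables among Xs. *)
Fixpoint so_vars_in (xs Xs : seq nat) (th : so_form) : bool :=
  match th with
  | SEq t1 t2 | SLt t1 t2 => term_vars_in xs t1 && term_vars_in xs t2
  | SMem t X => term_vars_in xs t && (X \in Xs)
  | SNot th1 => so_vars_in xs Xs th1
  | SAnd th1 th2 | SOr th1 th2 => so_vars_in xs Xs th1 && so_vars_in xs Xs th2
  | SExN x th1 | SAllN x th1 => so_vars_in (x :: xs) Xs th1
  | SExS X th1 | SAllS X th1 => so_vars_in xs (X :: Xs) th1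
  end.

Fixpoint arithmetical (th : so_form) : bool :=
  match th with
  | SEq _ _ | SLt _ _ | SMem _ _ => true
  | SNot th1 | SExN _ th1 | SAllN _ th1 => arithmetical th1
  | SAnd th1 th2 | SOr th1 th2 => arithmetical th1 && arithmetical th2
  | SExS _ _ | SAllS _ _ => false
  end.

Fixpoint is_Pi11 (th : so_form) : bool :=
  if th is SAllS _ th1 then is_Pi11 th1 else arithmetical th.

Fixpoint is_Sigma12 (th : so_form) : bool :=
  if th is SExS _ th1 then is_Sigma12 th1 else is_Pi11 th.

(* A is defined by a Sigma^1_2 formula whose only free variable is number
   variable 0; so the environments below matter only at that variable. *)
Definition Sigma12_set (A : set nat) : Prop :=
  exists th : so_form,
    [/\ is_Sigma12 th, so_vars_in [:: 0] [::] th &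
        forall n, A n <-> so_sat (fun=> n) (fun=> set0) th].

Definition Sigma12_hard (B : set nat) : Prop :=
  forall A : set nat, Sigma12_set A -> one_reducible A B.

(* Main.v *)
(* A number variable is a coordinate of the index: [mu X. psi \/ O_pi X],
   evaluated where coordinate [pi] is still 0, says that some value of [pi]
   satisfies [psi].  If the paths of all number coordinates are copies of one
   path that is not eventually periodic, then two coordinates are equal iff they
   see the same suffix, so equality of coordinates is a greatest fixpoint; and
   "copies of one aperiodic path" is itself expressible at the origin.
   Coordinates can only grow, but a difference [y] of two coordinates survives any number of
   simultaneous moves, so repeated addition of [y], hence multiplication, is
   expressible as well.  Set quantifiers become path quantifiers over the full
   binary Kripke structure, and the input [u] becomes a block of [u] next
   operators, which makes the reduction computable and injective. *)
From Stdlib Require Import Relation_Operators.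
From mathcomp Require Import all_boot zify.
From mathcomp Require Import boolp classical_sets.
Require Import Defs.

Set Implicit Arguments.
Unset Strict Implicit.
Unset Printing Implicit Defensive.

(** * Nondeterministic programs that move coordinates *)

Definition state := nat -> nat.

Definition bump_coord (s : state) (k n : nat) : state :=
  fun i => s i + (if i == k then n else 0).

(* A run can only increase coordinates: nothing is ever reset.  Below, [W k m]
   is the label seen by coordinate [k] at position [m]. *)
Inductive prog : Type :=
| PLab of nat
| PInc of nat
| PSeq of prog & prog
| PAlt of prog & prog
| PStar of prog
| PNot of prog.

Notation star := (clos_refl_trans_1n _).

(** This is the relational semantics of propositional dynamic logic: [PLab] and [PNot] are tests
    that do not move, and [holds] is the diamond of a program. *)
Fixpoint run (W : nat -> nat -> bool) (p : prog) (s t : state) : Prop :=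
  match p with
  | PLab k => W k (s k) /\ t = s
  | PInc k => t = bump_coord s k 1
  | PSeq p1 p2 => exists2 u, run W p1 s u & run W p2 u t
  | PAlt p1 p2 => run W p1 s t \/ run W p2 s t
  | PStar p1 => star (run W p1) s t
  | PNot p1 => t = s /\ ~ exists u, run W p1 s u
  end.

Definition holds W (s : state) (p : prog) : Prop := exists t, run W p s t.

Fixpoint max_coord (p : prog) : nat :=
  match p with
  | PLab k | PInc k => k
  | PSeq p1 p2 | PAlt p1 p2 => maxn (max_coord p1) (max_coord p2)
  | PStar p1 | PNot p1 => max_coord p1
  end.

(** * Free predicates, polarity and truth *)

Section FreePredicates.
Variables (AP : Type) (n : nat).
Implicit Type psi : qf AP n.

Lemma qf_preds_in_sub (Xs Ys : seq nat) psi :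
  {subset Xs <= Ys} -> qf_preds_in Xs psi -> qf_preds_in Ys psi.
Proof.
elim: psi Xs Ys => //= [X|psi1 IH1 psi2 IH2|X psi IH] Xs Ys sub.
- exact: sub.
- by case/andP=> /(IH1 _ _ sub)-> /(IH2 _ _ sub)->.
- apply: IH => Y; rewrite !inE => /orP[->//|/sub->]; exact: orbT.
Qed.

(** Without free occurrences both polarities hold vacuously. This serves closed formulas below [Neg]
    and continuations that avoid a bound predicate. *)
Lemma qf_preds_in_polarity b X (Xs : seq nat) psi :
  X \notin Xs -> qf_preds_in Xs psi -> polarity b X psi.
Proof.
elim: psi b Xs => //= [Y|psi1 IH1 psi2 IH2|psi IH|Y psi IH] b Xs XXs.
- by case: eqP => // -> XXs'; rewrite XXs' in XXs.
- by case/andP=> /(IH1 b _ XXs)-> /(IH2 b _ XXs)->.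
- exact: IH.
- case: eqVneq => //= YX; apply: IH; by rewrite inE negb_or eq_sym YX.
Qed.

End FreePredicates.

Lemma eq_qf_sem (AP S : finType) (K : kripke AP S) n (V V' : valuation K n)
    (Xs : seq nat) (psi : qf AP n) :
  qf_preds_in Xs psi -> {in Xs, V =1 V'} -> qf_sem V psi = qf_sem V' psi.
Proof.
elim: psi V V' Xs => [a i|X|i psi IH|psi1 IH1 psi2 IH2|psi IH|X psi IH]
  V V' Xs //=.
- by move=> XXs; apply.
- by move=> /IH{}IH /IH->.
- by case/andP=> /IH1{}IH1 /IH2{}IH2 VV'; rewrite (IH1 _ _ VV') (IH2 _ _ VV').
- by move=> /IH{}IH /IH->.
- move=> /IH{}IH VV'; congr lfp; apply/funext => xi; apply: IH => Y.
  by rewrite inE /update; case: eqP => //= _; exact: VV'.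
Qed.

(** The least fixpoint of the identity is empty, so its complement is everything. No atom occurs, so
    the formula exists for [n = 0] too. *)
Definition qf_true AP n : qf AP n := Neg (Mu 0 (Pred 0)).
Definition qf_and AP n (psi1 psi2 : qf AP n) := Neg (Or (Neg psi1) (Neg psi2)).

Lemma qf_sem_true (AP S : finType) (K : kripke AP S) n (V : valuation K n) Pi j :
  qf_sem V (qf_true AP n) Pi j.
Proof.
by move=> /= H; apply: (H (fun _ => set0)) => Pi' j'.
Qed.

Lemma qf_sem_and (AP S : finType) (K : kripke AP S) n (V : valuation K n)
    psi1 psi2 Pi j :
  qf_sem V (qf_and psi1 psi2) Pi j <-> qf_sem V psi1 Pi j /\ qf_sem V psi2 Pi j.
Proof.
split=> /= [H|[H1 H2] []//].
by split; apply: contrapT => N; apply: H; [left|right].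
Qed.

(** * Compiling programs *)

(* [dia N d p psi] expresses that some run of [p] leads to [psi]; predicates
   [d], [d+1], ... are fresh.  The coordinates of [p] must be at most [N]. *)
Fixpoint dia N d (p : prog) (psi : qf 'I_1 N.+1) : qf 'I_1 N.+1 :=
  match p with
  | PLab k => qf_and (Atom ord0 (inord k)) psi
  | PInc k => Next (inord k) psi
  | PSeq p1 p2 => dia d p1 (dia d p2 psi)
  | PAlt p1 p2 => Or (dia d p1 psi) (dia d p2 psi)
  | PStar p1 => Mu d (Or psi (dia d.+1 p1 (Pred d)))
  | PNot p1 => qf_and (Neg (dia 0 p1 (qf_true _ _))) psi
  end.

Definition compile N p := dia 0 p (qf_true 'I_1 N.+1).

Lemma dia_preds_in N d p psi Xs :
  qf_preds_in Xs psi -> qf_preds_in Xs (@dia N d p psi).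
Proof.
elim: p d psi Xs => //= [p1 IH1 p2 IH2|p1 IH1 p2 IH2|p IH|p IH] d psi Xs H.
- exact/IH1/IH2.
- by rewrite IH1 ?IH2.
- rewrite (qf_preds_in_sub _ H) => [|X XXs]; last by rewrite inE XXs orbT.
  by apply: IH; rewrite /= inE eqxx.
- by rewrite H IH //= inE eqxx.
Qed.

(** The continuation is negated only by the double negation in [qf_and]; the [Neg] added for [PNot]
    encloses a formula ending in [qf_true], which has no free predicate. *)
Lemma dia_polarity N d p psi X :
  polarity true X psi -> polarity true X (@dia N d p psi).
Proof.
elim: p d psi => //= [p1 IH1 p2 IH2|p1 IH1 p2 IH2|p IH|p IH] d psi H.
- exact/IH1/IH2.
- by rewrite IH1 ?IH2.
- by rewrite H IH ?orbT //= implybT.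
- by rewrite H andbT; apply: (@qf_preds_in_polarity _ _ _ _ [::]) => //;
    apply: dia_preds_in.
Qed.

Lemma pred_in_iota AP n d : qf_preds_in (iota 0 d.+1) (Pred d : qf AP n).
Proof. by change (d \in iota 0 d.+1); rewrite mem_iota add0n ltnSn. Qed.

(** The predicates of [psi] lie below [d], so the binder of [d] captures none of them. The formula
    negated for [PNot] is closed, so its numbering may restart at 0. *)
Lemma dia_wf N d p psi :
  qf_wf psi -> qf_preds_in (iota 0 d) psi -> qf_wf (@dia N d p psi).
Proof.
elim: p d psi => //= [p1 IH1 p2 IH2|p1 IH1 p2 IH2|p IH|p IH] d psi wf pi.
- by apply: IH1; [exact: IH2|exact: dia_preds_in].
- by rewrite IH1 ?IH2.
- rewrite wf dia_polarity /= ?implybT // andbT (qf_preds_in_polarity _ _ pi) /=;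
    last by rewrite mem_iota /= add0n ltnn.
  by apply: IH => //; exact: pred_in_iota.
- by rewrite wf andbT IH.
Qed.

(** * Correctness of the compilation *)

Section Correctness.
Variables (S : finType) (K : kripke 'I_1 S) (N : nat).

Definition labels_of (ps : nat -> path_of K) k m : bool :=
  ord0 \in label K (ps k m).

(** Programs address coordinates by arbitrary numbers, while assignments are finite: coordinates out
    of range get the default path [p0], and position 0 in [state_of]. *)
Definition paths_of (p0 : path_of K) n (Pi : assignment K n) : nat -> path_of K :=
  fun k => if insub k is Some i then Pi i else p0.

Definition state_of n (j : index n) : state :=
  fun k => if insub k is Some i then j i else 0.

Lemma state_of_shift (j : index N.+1) k : k <= N ->
  state_of (shift j (inord k)) = bump_coord (state_of j) k 1.
Proof.
move=> kN; apply/funext => i; rewrite /state_of /bump_coord.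
case: insubP => [u _ ui|]; last by case: eqP => // -> /negP.
rewrite ffunE -val_eqE /= inordK // ui.
by case: eqP.
Qed.

Lemma state_of_inord (j : index N.+1) k : k <= N -> j (inord k) = state_of j k.
Proof.
move=> kN; rewrite /state_of; case: insubP => [u _ uk|/negP//].
by congr (j _); apply/val_inj; rewrite /= inordK.
Qed.

Lemma state_of_inj n : injective (@state_of n).
Proof.
move=> j j' /(congr1 (fun s => s _)) E; apply/ffunP => i.
by have := E (val i); rewrite /state_of valK.
Qed.

Variable p0 : path_of K.
Implicit Types (Pi : assignment K N.+1) (j : index N.+1).

Let W Pi := labels_of (paths_of p0 Pi).

(** A run may pass through any state, but formulas see only indices. A program bounded by [N] leaves
    the coordinates beyond [N] at 0, so it never leaves the indices. *)
Lemma run_state_of p Pi j t : max_coord p <= N ->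
  run (W Pi) p (state_of j) t -> exists j', t = state_of j'.
Proof.
elim: p j t => [k|k|p1 IH1 p2 IH2|p1 IH1 p2 IH2|p IH|p IH] j t /=.
- by move=> _ [_ ->]; exists j.
- by move=> kN ->; rewrite -state_of_shift //; eexists.
- rewrite geq_max => /andP[N1 N2] [u /(IH1 _ _ N1)[j1 ->]]; exact: IH2.
- by rewrite geq_max => /andP[N1 N2] [/(IH1 _ _ N1)|/(IH2 _ _ N2)].
- move=> pN; move Ej: (state_of j) => s st.
  elim: st j Ej => {s t} [s|s u t su _ IHs] j sj; first by exists j.
  by move: su; rewrite -sj => /(IH _ _ pN)[j' /esym/IHs].
- by move=> _ [-> _]; exists j.
Qed.

Lemma dia_correct d p psi V Pi j : max_coord p <= N ->
  qf_preds_in (iota 0 d) psi ->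
  qf_sem V (dia d p psi) Pi j <->
  exists j', run (W Pi) p (state_of j) (state_of j') /\ qf_sem V psi Pi j'.
Proof.
elim: p d psi V Pi j => [k|k|p1 IH1 p2 IH2|p1 IH1 p2 IH2|p IH|p IH] d psi V Pi j.
- move=> kN _; rewrite [dia _ _ _]/= qf_sem_and /=.
  have -> : (ord0 \in label K (Pi (inord k) (j (inord k)))) = W Pi k (state_of j k).
    rewrite /W /labels_of -state_of_inord //; congr (_ \in label K (_ _)).
    rewrite /paths_of; case: insubP => [u _ uk|/negP//].
    by congr (Pi _); apply/val_inj; rewrite /= inordK.
  split=> [[L psij]|[j' [[L /state_of_inj ->]]]]; last by [].
  by exists j.
- move=> kN _ /=; rewrite -state_of_shift //.
  split=> [H|[j' [/state_of_inj-> //]]]; by exists (shift j (inord k)).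
- rewrite /= geq_max => /andP[N1 N2] pi.
  rewrite IH1 //; last exact: dia_preds_in.
  split=> [[j1 [r1]]|[j2 [[u r1 r2] psij]]].
    rewrite IH2 // => -[j2 [r2 psij]]; exists j2; split=> //.
    by exists (state_of j1).
  have [j1 uj] := run_state_of N1 r1; subst u; exists j1; split=> //.
  by rewrite IH2 //; exists j2.
- rewrite /= geq_max => /andP[N1 N2] pi.
  split=> [[/IH1|/IH2]|[j' [[r|r] psij]]].
  + by case/(_ N1 pi) => j' [r psij]; exists j'; split=> //; left.
  + by case/(_ N2 pi) => j' [r psij]; exists j'; split=> //; right.
  + by left; apply/IH1 => //; exists j'.
  + by right; apply/IH2 => //; exists j'.
- move=> /= pN pi.
  have piS := @pred_in_iota 'I_1 N.+1 d.
  have psiU xi : qf_sem (update V d xi) psi = qf_sem V psi.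
    apply: (eq_qf_sem pi) => X; rewrite mem_iota add0n /update.
    by case: eqP => // ->; rewrite ltnn.
  split=> [|[j' [r psij]]].
    (* Existence of a run reaching [psi] is a prefixed point, so it contains the least fixpoint. *)
    move=> /(_ (fun Pi j => exists j',
      star (run (W Pi) p) (state_of j) (state_of j') /\ qf_sem V psi Pi j')).
    apply=> {}Pi {}j /=; rewrite psiU => -[psij|].
      by exists j; split=> //; apply: rt1n_refl.
    rewrite IH // => -[j1 [r1]]; rewrite /= /update eqxx => -[j2 [r2 psij]].
    by exists j2; split=> //; apply: rt1n_trans r1 r2.
  (* Conversely, every prefixed point contains the start of each such run, by induction on the
     run. *)
  move=> xi /= xiP.
  move Ej: (state_of j) r => s; move Ej': (state_of j') => s' r.
  elim: r j Ej Ej' => {s s'} [s|s u s' r _ IHs] j sj sj'; apply: xiP.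
    by left; rewrite psiU; rewrite -sj' in sj; rewrite (state_of_inj sj).
  right; rewrite IH //; subst s; have [j1 uj] := run_state_of pN r.
  subst u; exists j1; split=> //=.
  by rewrite /update eqxx; apply: IHs.
- rewrite [max_coord _]/= => pN pi; rewrite [dia _ _ _]/= qf_sem_and.
  change (qf_sem V (Neg ?a) Pi j) with (~ qf_sem V a Pi j).
  rewrite IH //.
  split=> [[np psij]|[j' [[/state_of_inj-> np] psij]]].
    exists j; split=> //; split=> // -[t r]; have [j' tj] := run_state_of pN r.
    by subst t; apply: np; exists j'; split=> //; apply: qf_sem_true.
  by split=> // -[j'' [r _]]; apply: np; exists (state_of j'').
Qed.

Lemma compile_correct p V Pi j : max_coord p <= N ->
  qf_sem V (compile N p) Pi j <-> holds (W Pi) (state_of j) p.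
Proof.
move=> pN; rewrite /compile dia_correct //.
split=> [[j' [r _]]|[t r]]; first by exists (state_of j').
have [j' tj] := run_state_of pN r; subst t; exists j'; split=> //.
exact: qf_sem_true.
Qed.

End Correctness.

(** * Programs for arithmetic *)

(** Moves cannot be undone, so a check that moves coordinates is performed aside: the double
    negation keeps only whether [p] can run. *)
Definition PTest p := PNot (PNot p).

Local Notation "p ;; q" := (PSeq p q) (at level 61, right associativity).

Definition pneq k l :=
  PAlt (PLab k ;; PNot (PLab l)) (PNot (PLab k) ;; PLab l).
Definition peq k l := PNot (PStar (PInc k ;; PInc l) ;; pneq k l).

(** Variable [x] sits on coordinate [c x], coordinate [h] is compared with the value, and scratch
    space starts at [b]. Values of subterms are guessed by increments, then checked. In a product,
    [b.+2] counts rounds, [b.+3] holds the current multiple of the second factor, and [b.+4] and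
    [b.+4.+1] hold the next one. *)
Fixpoint pterm (c : nat -> nat) (t : term) (h b : nat) : prog :=
  match t with
  | TVar x => peq (c x) h
  | TZero => peq b h
  | TSucc t1 => PStar (PInc b) ;; PTest (pterm c t1 b b.+1) ;; PInc b ;; peq b h
  | TAdd t1 t2 =>
      PStar (PInc b) ;; PTest (pterm c t1 b b.+1) ;;
      PStar (PInc b.+1) ;; PTest (pterm c t2 b.+1 b.+2) ;;
      PStar (PInc b ;; PInc b.+2) ;; peq b.+2 b.+1 ;; peq b h
  | TMul t1 t2 =>
      PStar (PInc b) ;; PTest (pterm c t1 b b.+1) ;;
      PStar (PInc b.+1) ;; PTest (pterm c t2 b.+1 b.+2) ;;
      PStar (PInc b.+4 ;; PInc b.+4.+1) ;; peq b.+4 b.+1 ;;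
      PStar (PInc b.+2 ;; PStar (PInc b.+3 ;; PInc b.+4) ;; peq b.+3 b.+4.+1 ;;
             PStar (PInc b.+4.+1) ;; peq b.+4.+1 b.+4) ;;
      peq b.+2 b ;; peq b.+3 h
  end.

(** Membership moves a set coordinate for good; [PTest] around the first conjunct keeps that
    coordinate at 0 for the second. *)
Fixpoint pform (C c : nat -> nat) (th : so_form) (b : nat) : prog :=
  match th with
  | SEq t1 t2 =>
      PStar (PInc b) ;; PTest (pterm c t1 b b.+1) ;; pterm c t2 b b.+1
  | SLt t1 t2 =>
      PStar (PInc b) ;; PTest (pterm c t1 b b.+1) ;;
      PInc b ;; PStar (PInc b) ;; pterm c t2 b b.+1
  | SMem t X =>
      PStar (PInc b) ;; PTest (pterm c t b b.+1) ;;
      PStar (PInc b.+1 ;; PInc (C X)) ;; peq b.+1 b ;; PInc (C X) ;; PLab (C X)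
  | SNot th1 => PNot (pform C c th1 b)
  | SAnd th1 th2 => PTest (pform C c th1 b) ;; pform C c th2 b
  | SOr th1 th2 => PAlt (pform C c th1 b) (pform C c th2 b)
  | SExN x th1 => PStar (PInc b) ;; pform C (env_update c x b) th1 b.+1
  | SAllN x th1 =>
      PNot (PStar (PInc b) ;; PNot (pform C (env_update c x b) th1 b.+1))
  | SExS _ _ | SAllS _ _ => PNot (PLab 0)
  end.

Definition bump2 (s : state) k l n := bump_coord (bump_coord s k n) l n.

Ltac decide_coords :=
  rewrite /bump2 /bump_coord;
  repeat match goal with |- context [@eq_op _ ?x ?y] =>
    first [have -> : (x == y) = true by lia | have -> : (x == y) = false by lia]
  end; rewrite /= ?addn0.

(** * Correctness of the arithmetic programs *)

Section Arithmetic.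
Variable W : nat -> nat -> bool.
Implicit Types (s : state) (p q : prog).

Lemma holds_test s p q : holds W s (PTest p ;; q) <-> holds W s p /\ holds W s q.
Proof.
split=> [[t [u [-> np] r]]|[hp [t r]]]; last first.
  by exists t; exists s => //; split=> // -[u [_]].
split; last by exists t.
by apply: contrapT => nh; apply: np; exists s.
Qed.

Lemma holds_seq s p q : holds W s (p ;; q) <-> exists2 t, run W p s t & holds W t q.
Proof.
split=> [[t [u r r']]|[u r [t r']]]; first by exists u => //; exists t.
by exists t; exists u.
Qed.

Lemma holds_inc s k q : holds W s (PInc k ;; q) <-> holds W (bump_coord s k 1) q.
Proof.
rewrite holds_seq; split=> [[t ->]//|h]; by exists (bump_coord s k 1).
Qed.

Lemma bump_coord0 s k : bump_coord s k 0 = s.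
Proof. by apply/funext => i; rewrite /bump_coord; case: eqP; rewrite addn0. Qed.

Lemma bump_coordD s k m n :
  bump_coord (bump_coord s k m) k n = bump_coord s k (m + n).
Proof.
by apply/funext => i; rewrite /bump_coord; case: eqP; rewrite ?addn0 ?addnA.
Qed.

Lemma bump_coordC s k l m n :
  bump_coord (bump_coord s k m) l n = bump_coord (bump_coord s l n) k m.
Proof. by apply/funext => i; rewrite /bump_coord addnAC. Qed.

Lemma run_star_inc s k t :
  run W (PStar (PInc k)) s t <-> exists n, t = bump_coord s k n.
Proof.
split=> [|[n ->]].
  elim=> [u|u v w /= -> _ [n ->]]; first by exists 0; rewrite bump_coord0.
  by exists n.+1; rewrite bump_coordD add1n.
elim: n s => [|n IHn] s; first by rewrite bump_coord0; apply: rt1n_refl.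
rewrite -add1n -bump_coordD; apply: rt1n_trans (IHn _); by [].
Qed.

Lemma run_star_inc2 s k l t :
  run W (PStar (PInc k ;; PInc l)) s t <-> exists n, t = bump2 s k l n.
Proof.
rewrite /bump2; split=> [|[n ->]].
  elim=> [u|u v w /= [_ -> ->] _ [n ->]]; first by exists 0; rewrite !bump_coord0.
  by exists n.+1; rewrite (bump_coordC _ l) !bump_coordD add1n.
elim: n s => [|n IHn] s; first by rewrite !bump_coord0; apply: rt1n_refl.
apply: (@rt1n_trans _ _ _ (bump2 s k l 1)); first by exists (bump_coord s k 1).
have -> : bump_coord (bump_coord s k n.+1) l n.+1 =
    bump_coord (bump_coord (bump2 s k l 1) k n) l n; last exact: IHn.
by rewrite /bump2 (bump_coordC _ l) !bump_coordD add1n.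
Qed.

Lemma holds_star_inc s k q :
  holds W s (PStar (PInc k) ;; q) <-> exists n, holds W (bump_coord s k n) q.
Proof.
rewrite holds_seq; split=> [[t /run_star_inc[n ->]]|[n h]]; first by exists n.
by exists (bump_coord s k n) => //; apply/run_star_inc; exists n.
Qed.

Lemma holds_star_inc2 s k l q :
  holds W s (PStar (PInc k ;; PInc l) ;; q) <-> exists n, holds W (bump2 s k l n) q.
Proof.
rewrite holds_seq; split=> [[t /run_star_inc2[n ->]]|[n h]]; first by exists n.
by exists (bump2 s k l n) => //; apply/run_star_inc2; exists n.
Qed.

Lemma holds_pneq s k l : holds W s (pneq k l) <-> W k (s k) != W l (s l).
Proof.
split=> [[t /= [[u [kk ->] [_ nl]]|[u [-> nk] [ll _]]]]|].
- rewrite kk; case E: (W l (s l)) => //; case: nl; by exists s.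
- rewrite ll; case E: (W k (s k)) => //; case: nk; by exists s.
- move=> ne; exists s => /=; case E: (W k (s k)) ne => /= ne; [left|right].
    by exists s => //; split=> // -[_ [h _]]; rewrite h in ne.
  exists s => //; split=> //; first by case=> _ [h _].
  by case: (W l _) ne.
Qed.

Lemma run_peq_labels s t k l : k != l ->
  run W (peq k l) s t <-> t = s /\ forall i, W k (s k + i) = W l (s l + i).
Proof.
(* As [k != l], exactly [n] is added to each coordinate; for [k = l] it would be [2 * n]. *)
move=> kl; have E n : bump2 s k l n k = s k + n /\ bump2 s k l n l = s l + n.
  by rewrite /bump2 /bump_coord !eqxx (negPf kl) eq_sym (negPf kl); lia.
rewrite /= -/(holds W s (PStar (PInc k ;; PInc l) ;; pneq k l)).
split=> -[-> H]; split=> //; first move=> n.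
  apply/eqP; apply: contrapT => /negP ne; apply: H.
  rewrite holds_star_inc2; exists n; rewrite holds_pneq.
  by have [-> ->] := E n.
rewrite holds_star_inc2 => -[n]; rewrite holds_pneq.
by have [-> ->] := E n; rewrite H eqxx.
Qed.

(* Coordinates from [K0] on all see the same path, no two suffixes of which
   coincide; hence positions on these coordinates can be compared. *)
Variable K0 : nat.
Hypothesis W_const : forall k i, K0 <= k -> W k i = W K0 i.
Hypothesis W_aperiodic : forall a b, (forall i, W K0 (a + i) = W K0 (b + i)) -> a = b.

Lemma run_peq s t k l : K0 <= k -> K0 <= l ->
  run W (peq k l) s t <-> t = s /\ s k = s l.
Proof.
move=> Kk Kl; have [kl|kl] := eqVneq k l; last first.
  rewrite run_peq_labels //; split=> -[-> E]; split=> //.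
    by apply: W_aperiodic => i; rewrite -(W_const _ Kk) -(W_const _ Kl).
  by move=> i; rewrite (W_const _ Kk) (W_const _ Kl) E.
(* For [k = l] the loop moves the coordinate twice per round, but no label ever differs from
   itself. *)
subst l; split=> [[]//|[-> _]]; split=> //.
move=> [u [v _ r]]; have /holds_pneq : holds W v (pneq k k) by exists u.
by rewrite eqxx.
Qed.

Lemma holds_peq s k l : K0 <= k -> K0 <= l -> holds W s (peq k l) <-> s k = s l.
Proof.
move=> Kk Kl; split=> [[t /run_peq[]//]|E]; by exists s; apply/run_peq.
Qed.

Lemma holds_peq_seq s k l q : K0 <= k -> K0 <= l ->
  holds W s (peq k l ;; q) <-> s k = s l /\ holds W s q.
Proof.
move=> Kk Kl; rewrite holds_seq; split=> [[t /run_peq[]// -> ->//]|[E h]].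
by exists s => //; apply/run_peq.
Qed.

Definition fresh s b := forall i, b <= i -> s i = 0.

Lemma freshS s b n : fresh s b -> fresh (bump_coord s b n) b.+1.
Proof.
move=> H i bi; rewrite /bump_coord H ?(ltnW bi) //.
by case: eqP bi => // ->; rewrite ltnn.
Qed.

(* Body of the multiplication loop, where [a], [b'], [c] are the coordinates
   [b + 3], [b + 4], [b + 5]: if [c = b'] and [b' = a + y] initially, then [a]
   moves to the old value of [b'] and [b'], [c] both become [a + 2 y]. *)
Let mul_step b :=
  PInc b.+2 ;; PStar (PInc b.+3 ;; PInc b.+4) ;; peq b.+3 b.+4.+1 ;;
  PStar (PInc b.+4.+1) ;; peq b.+4.+1 b.+4.

(** The loop invariant: the state after [i] rounds, with [y] the second factor. *)
Let mul_state s b y i : state :=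
  fun k => if k == b.+2 then i else if k == b.+3 then i * y
    else if (k == b.+4) || (k == b.+4.+1) then i.+1 * y else s k.

Lemma mul_stateS s b y i :
  mul_state s b y i.+1 =
  bump_coord (bump2 (bump_coord (mul_state s b y i) b.+2 1) b.+3 b.+4 y) b.+4.+1 y.
Proof.
apply/funext => k; rewrite /mul_state.
have [->|k2] := eqVneq k b.+2; first by decide_coords; lia.
have [->|k3] := eqVneq k b.+3; first by decide_coords; lia.
have [->|k4] := eqVneq k b.+4; first by decide_coords; lia.
have [->|k5] := eqVneq k b.+4.+1; first by decide_coords; lia.
by decide_coords.
Qed.

Lemma run_mul_step s b y i t : K0 <= b ->
  run W (mul_step b) (mul_state s b y i) t <-> t = mul_state s b y i.+1.
Proof.
move=> Kb; have K k : K0 <= k + b by lia.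
rewrite /mul_step; split.
  move=> [u1 u1E [u2 /run_star_inc2[n u2E] [u3]]].
  move=> /(run_peq _ _ (K 3) (K 5))[u3E E1] [u4 /run_star_inc[m u4E]].
  move=> /(run_peq _ _ (K 5) (K 4))[-> E2]; subst u4 u3 u2 u1.
  (* The comparisons read [i * y + n = i.+1 * y] and [i.+1 * y + m = i.+1 * y + n], so both guesses
     are forced. *)
  have {}E1 : n = y by move: E1; rewrite /mul_state; decide_coords; lia.
  have {}E2 : m = y by move: E2; rewrite /mul_state; decide_coords; lia.
  by rewrite E1 E2 -mul_stateS.
move=> ->.
exists (bump_coord (mul_state s b y i) b.+2 1) => //.
exists (bump2 (bump_coord (mul_state s b y i) b.+2 1) b.+3 b.+4 y).
  by apply/run_star_inc2; exists y.
set u := bump2 _ _ _ _; exists u.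
  apply/(run_peq _ _ (K 3) (K 5)); split=> //.
  by rewrite /u /mul_state; decide_coords; lia.
exists (mul_state s b y i.+1).
  by apply/run_star_inc; exists y; rewrite mul_stateS.
apply/(run_peq _ _ (K 5) (K 4)); split=> //.
by rewrite /mul_state; decide_coords.
Qed.

Lemma run_mul_loop s b y t : K0 <= b ->
  run W (PStar (mul_step b)) (mul_state s b y 0) t <->
  exists i, t = mul_state s b y i.
Proof.
move=> Kb; split=> [|[n ->]].
  move E: (mul_state s b y 0) => u r.
  have {E} : exists i, u = mul_state s b y i by exists 0.
  elim: r => {u t} [//|u v t uv _ IH [i ui]]; apply: IH; exists i.+1.
  by move: uv; rewrite ui => /run_mul_step->.
(* The induction peels off the first round, so the starting round must vary. *)
suff H m : run W (PStar (mul_step b)) (mul_state s b y m) (mul_state s b y (m + n)).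
  exact: (H 0).
elim: n m => [|n IHn] m; first by rewrite addn0; apply: rt1n_refl.
rewrite addnS -addSn; apply: rt1n_trans (IHn _).
exact/run_mul_step.
Qed.

(** Guess and check acts as an assignment: the test admits a single guess and leaves the state where
    it was. *)
Lemma holds_guess s b p v q : fresh s b ->
  (forall n, holds W (bump_coord s b n) p <-> n = v) ->
  holds W s (PStar (PInc b) ;; PTest p ;; q) <-> holds W (bump_coord s b v) q.
Proof.
move=> sb pv; rewrite holds_star_inc; split=> [[n]|h].
  by rewrite holds_test pv => -[->].
by exists v; rewrite holds_test pv.
Qed.

Definition reads (c e : nat -> nat) (xs : seq nat) b s :=
  {in xs, forall x, K0 <= c x < b /\ s (c x) = e x}.

Lemma reads_bump c e xs b s n :
  reads c e xs b s -> reads c e xs b.+1 (bump_coord s b n).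
Proof.
move=> H x /H[] /andP[-> cb] <-; split; first by rewrite ltnW.
by rewrite /bump_coord; case: eqP cb => [->|]; rewrite ?ltnn ?addn0.
Qed.

Lemma holds_pterm c e xs tm s h b : term_vars_in xs tm -> K0 <= h < b ->
  reads c e xs b s -> fresh s b ->
  holds W s (pterm c tm h b) <-> s h = term_eval e tm.
Proof.
have guess t1 s1 b1 q :
    (forall s h b, term_vars_in xs t1 -> K0 <= h < b ->
      reads c e xs b s -> fresh s b ->
      holds W s (pterm c t1 h b) <-> s h = term_eval e t1) ->
    term_vars_in xs t1 -> K0 <= b1 -> reads c e xs b1 s1 -> fresh s1 b1 ->
    holds W s1 (PStar (PInc b1) ;; PTest (pterm c t1 b1 b1.+1) ;; q) <->
    holds W (bump_coord s1 b1 (term_eval e t1)) q.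
  move=> IH v1 Kb r f; apply: holds_guess => // n.
  rewrite IH ?Kb ?ltnSn //; [|exact: reads_bump|exact: freshS].
  by rewrite /bump_coord eqxx f.
elim: tm s h b => [x||t1 IH1|t1 IH1 t2 IH2|t1 IH1 t2 IH2] s h b /= v Kh r f;
  have K k : K0 <= k + b by lia.
all: have Kh' : K0 <= h by lia.
- have [/andP[Kx _] <-] := r _ v.
  by rewrite holds_peq //; split.
- by rewrite (holds_peq _ (K 0)) // f //; split.
- rewrite guess // ?(K 0) // holds_inc (holds_peq _ (K 0)) //.
  have -> : bump_coord (bump_coord s b (term_eval e t1)) b 1 h = s h.
    by decide_coords.
  have -> : bump_coord (bump_coord s b (term_eval e t1)) b 1 b = (term_eval e t1).+1.
    by decide_coords; rewrite f // addn1.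
  by split.
- have [v1 v2] := andP v.
  rewrite guess // ?(K 0) // guess // ?(K 1) //;
    [|exact: reads_bump|exact: freshS].
  set s2 := bump_coord _ _ _; set n1 := term_eval e t1; set n2 := term_eval e t2.
  have E n : [/\ bump2 s2 b b.+2 n b.+2 = n, bump2 s2 b b.+2 n b.+1 = n2,
      bump2 s2 b b.+2 n b = n1 + n & bump2 s2 b b.+2 n h = s h].
    by rewrite /s2 -/n1 -/n2; split; decide_coords; rewrite // f //; lia.
  (* Comparing [b.+2] with [b.+1] forces [n = n2] joint moves, after which [b] holds [n1 + n2]. *)
  rewrite holds_star_inc2; split=> [[n]|sh].
    rewrite (holds_peq_seq _ _ (K 2) (K 1)) (holds_peq _ (K 0)) //.
    by have [-> -> -> ->] := E n => -[-> ->].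
  exists n2; rewrite (holds_peq_seq _ _ (K 2) (K 1)) (holds_peq _ (K 0)) //.
  by have [-> -> -> ->] := E n2.
- have [v1 v2] := andP v.
  rewrite guess // ?(K 0) // guess // ?(K 1) //;
    [|exact: reads_bump|exact: freshS].
  set s2 := bump_coord _ _ _; set n1 := term_eval e t1; set n2 := term_eval e t2.
  have E n : bump2 s2 b.+4 b.+4.+1 n b.+4 = n /\ bump2 s2 b.+4 b.+4.+1 n b.+1 = n2.
    by rewrite /s2 -/n1 -/n2; split; decide_coords; rewrite // f //; lia.
  (* Laying out the second factor on the last two coordinates establishes the invariant at round
     0. *)
  have init : bump2 s2 b.+4 b.+4.+1 n2 = mul_state s2 b n2 0.
    apply/funext => k; rewrite /mul_state.
    have [->|k2] := eqVneq k b.+2; first by rewrite /s2; decide_coords; rewrite f; lia.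
    have [->|k3] := eqVneq k b.+3; first by rewrite /s2; decide_coords; rewrite f; lia.
    have [->|k4] := eqVneq k b.+4; first by rewrite /s2; decide_coords; rewrite f; lia.
    have [->|k5] := eqVneq k b.+4.+1; first by rewrite /s2; decide_coords; rewrite f; lia.
    by decide_coords.
  have F i : [/\ mul_state s2 b n2 i b.+2 = i, mul_state s2 b n2 i b = n1,
      mul_state s2 b n2 i b.+3 = i * n2 & mul_state s2 b n2 i h = s h].
    by rewrite /s2 -/n1 -/n2 /mul_state; split; decide_coords; rewrite // f //; lia.
  rewrite holds_star_inc2; split=> [[n]|sh].
    rewrite (holds_peq_seq _ _ (K 4) (K 1)).
    have [-> ->] := E n => -[->]; rewrite init holds_seq => -[u].
    move=> /(run_mul_loop _ _ _ (K 0))[i ->].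
    (* The exit test on [b.+2] and [b] forces [i = n1], so [b.+3] holds [n1 * n2]. *)
    rewrite (holds_peq_seq _ _ (K 2) (K 0)) (holds_peq _ (K 3)) //.
    by have [-> -> -> ->] := F i => -[-> ->].
  exists n2; rewrite (holds_peq_seq _ _ (K 4) (K 1)).
  have [-> ->] := E n2; split=> //; rewrite init holds_seq.
  exists (mul_state s2 b n2 n1); first by apply/(run_mul_loop _ _ _ (K 0)); exists n1.
  rewrite (holds_peq_seq _ _ (K 2) (K 0)) (holds_peq _ (K 3)) //.
  by have [-> -> -> ->] := F n1.
Qed.

(* A set is read off from a path one step late, because the first state of
   every path is the initial one. *)
Lemma holds_pform C c e E xs Xs th s b :
  arithmetical th -> so_vars_in xs Xs th -> K0 <= b ->
  reads c e xs b s -> fresh s b ->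
  {in Xs, forall X, [/\ C X < K0, s (C X) = 0 & forall m, E X m <-> W (C X) m.+1]} ->
  holds W s (pform C c th b) <-> so_sat e E th.
Proof.
(* Set coordinates lie below [K0], so moving number coordinates leaves them at 0. *)
have bumpC s1 b1 n : K0 <= b1 ->
    {in Xs, forall X, [/\ C X < K0, s1 (C X) = 0 & forall m, E X m <-> W (C X) m.+1]} ->
    {in Xs, forall X, [/\ C X < K0, bump_coord s1 b1 n (C X) = 0
      & forall m, E X m <-> W (C X) m.+1]}.
  move=> Kb H X XXs; have [CK sC EW] := H X XXs; split=> //.
  by decide_coords.
have guess e1 c1 xs1 t1 s1 b1 q : term_vars_in xs1 t1 -> K0 <= b1 ->
    reads c1 e1 xs1 b1 s1 -> fresh s1 b1 ->
    holds W s1 (PStar (PInc b1) ;; PTest (pterm c1 t1 b1 b1.+1) ;; q) <->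
    holds W (bump_coord s1 b1 (term_eval e1 t1)) q.
  move=> v1 Kb r f; apply: holds_guess => // n.
  rewrite (@holds_pterm _ e1 xs1) ?Kb ?ltnSn //; [|exact: reads_bump|exact: freshS].
  by rewrite /bump_coord eqxx f.
elim: th c e xs s b => [t1 t2|t1 t2|tm X|th IH|th1 IH1 th2 IH2|th1 IH1 th2 IH2|
  x th IH|x th IH|//|//] c e xs s b /= ar v Kb r f Cs.
- have [v1 v2] := andP v; rewrite (@guess e _ xs) //.
  rewrite (@holds_pterm _ e xs) ?Kb ?ltnSn //; [|exact: reads_bump|exact: freshS].
  by rewrite /bump_coord eqxx f.
- have [v1 v2] := andP v; rewrite (@guess e _ xs) // holds_inc holds_star_inc.
  have P n : holds W (bump_coord (bump_coord (bump_coord s b (term_eval e t1)) b 1) b n)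
      (pterm c t2 b b.+1) <-> (term_eval e t1).+1 + n = term_eval e t2.
    rewrite !bump_coordD (@holds_pterm _ e xs) ?Kb ?ltnSn //;
      [|exact: reads_bump|exact: freshS].
    rewrite /bump_coord eqxx f //; split; lia.
  split=> [[n /P <-]|lt]; first by rewrite leq_addr.
  by exists (term_eval e t2 - (term_eval e t1).+1); apply/P; rewrite subnKC.
- have [v1 XXs] := andP v; rewrite (@guess e _ xs) // holds_star_inc2.
  have [CK sC EW] := Cs _ XXs; set n1 := term_eval e tm.
  have E1 n : [/\ bump2 (bump_coord s b n1) b.+1 (C X) n b.+1 = n,
      bump2 (bump_coord s b n1) b.+1 (C X) n b = n1 &
      bump_coord (bump2 (bump_coord s b n1) b.+1 (C X) n) (C X) 1 (C X) = n.+1].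
    by split; decide_coords; rewrite ?sC ?f //; lia.
  have P n q : holds W (bump2 (bump_coord s b n1) b.+1 (C X) n) (peq b.+1 b ;; q) <->
      n = n1 /\ holds W (bump2 (bump_coord s b n1) b.+1 (C X) n) q.
    rewrite holds_peq_seq //; last by lia.
    by have [-> -> _] := E1 n.
  have L n : holds W (bump2 (bump_coord s b n1) b.+1 (C X) n)
      (PInc (C X) ;; PLab (C X)) <-> E X n.
    rewrite holds_inc EW; have [_ _ E3] := E1 n.
    split=> [[t /= [h _]]|h]; first by rewrite E3 in h.
    by eexists; split; first rewrite E3.
  split=> [[n /P[-> /L]]//|h].
  by exists n1; apply/P; split=> //; apply/L.
- rewrite -(IH c e xs s b) //; split=> [[t [_ n]]//|n]; by exists s.
- have [a1 a2] := andP ar; have [v1 v2] := andP v.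
  by rewrite holds_test (IH1 c e xs) // (IH2 c e xs).
- have [a1 a2] := andP ar; have [v1 v2] := andP v.
  rewrite -(IH1 c e xs s b) // -(IH2 c e xs s b) //.
  split=> [[t [h|h]]|[[t h]|[t h]]].
  + by left; exists t.
  + by right; exists t.
  + by exists t; left.
  + by exists t; right.
(* Coordinate [b] now stores the quantified value, so scratch space moves up to [b.+1]. *)
- have P n : holds W (bump_coord s b n) (pform C (env_update c x b) th b.+1) <->
      so_sat (env_update e x n) E th.
    apply: (IH _ _ (x :: xs)) => //; [exact: ltnW| |exact: freshS|exact: bumpC].
    move=> y; rewrite inE /env_update; case: eqP => [_ _|_ /= yxs].
      by rewrite Kb ltnSn /bump_coord eqxx f.
    exact: (@reads_bump c e xs b s n r y yxs).
  by rewrite holds_star_inc; split=> -[n /P]; exists n.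
- have P n : holds W (bump_coord s b n) (pform C (env_update c x b) th b.+1) <->
      so_sat (env_update e x n) E th.
    apply: (IH _ _ (x :: xs)) => //; [exact: ltnW| |exact: freshS|exact: bumpC].
    move=> y; rewrite inE /env_update; case: eqP => [_ _|_ /= yxs].
      by rewrite Kb ltnSn /bump_coord eqxx f.
    exact: (@reads_bump c e xs b s n r y yxs).
  have N p : holds W s (PNot p) <-> ~ holds W s p.
    by split=> [[t [_ n]]//|n]; exists s.
  rewrite N holds_star_inc; split=> [H n|H [n [t [_ np]]]]; last exact/np/P.
  apply/P; apply: contrapT => nh; apply: H; exists n.
  by exists (bump_coord s b n).
Qed.

End Arithmetic.

(** * Aperiodic paths *)

Lemma bits_total :
  [forall s : 'I_2, exists t : 'I_2, (s, t) \in [set: 'I_2 * 'I_2]%SET].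
Proof. by apply/forallP => s; apply/existsP; exists s; rewrite finset.in_setT. Qed.

(** All transitions are allowed, so paths are arbitrary bit sequences except that the first bit is
    0. *)
Definition bits : kripke 'I_1 'I_2 :=
  Kripke ord0 [ffun s => [set _ | s == ord_max]%SET] bits_total.

Definition bit_pos (b : nat -> bool) (m : nat) : 'I_2 :=
  if (m != 0) && b m then ord_max else ord0.

Lemma bit_pos_trans b m : (bit_pos b m, bit_pos b m.+1) \in trans bits.
Proof. by rewrite finset.in_setT. Qed.

Definition bit_path (b : nat -> bool) : path_of bits :=
  Path (erefl : bit_pos b 0 = init bits) (bit_pos_trans b).

Lemma labels_of_bit_path (ps : nat -> path_of bits) b k m :
  ps k = bit_path b -> labels_of ps k m = (m != 0) && b m.
Proof.
rewrite /labels_of => ->; rewrite ffunE finset.in_set /= /bit_pos.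
by case: ifP.
Qed.

Definition is_pow2 m : bool := `[< exists k, m = 2 ^ k >].

(* With [b + i = 2 ^ b.+1] and [a < b], the number [a + i] lies strictly between
   two consecutive powers of 2. *)
Lemma is_pow2_aperiodic a b :
  (forall i, (a + i != 0) && is_pow2 (a + i) = (b + i != 0) && is_pow2 (b + i)) ->
  a = b.
Proof.
wlog ab : a b / a < b.
  move=> W H; have [/W->//|/W->//|//] := ltngtP a b; by move=> i; rewrite H.
move=> /(_ (2 ^ b.+1 - b)); have lt : b < 2 ^ b by exact: ltn_expl.
have E : 2 ^ b.+1 = 2 ^ b + 2 ^ b by rewrite expnS; lia.
have -> : b + (2 ^ b.+1 - b) = 2 ^ b.+1 by lia.
have -> : is_pow2 (2 ^ b.+1) by apply/asboolP; exists b.+1.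
have -> : (2 ^ b.+1 != 0) by rewrite -lt0n expn_gt0.
move=> /andP[_ /asboolP[k kE]].
have : 2 ^ b < 2 ^ k by lia.
have : 2 ^ k < 2 ^ b.+1 by lia.
rewrite !ltn_exp2l //; lia.
Qed.

(** A coordinate has only one position, so the later suffix is read on the copy at [K0.+1]; the lone
    [PInc] makes the two positions distinct. *)
Definition paperiodic K0 :=
  PNot (PStar (PInc K0 ;; PInc K0.+1) ;; PInc K0.+1 ;; PStar (PInc K0.+1) ;;
        peq K0 K0.+1).

Definition pcopies K0 N :=
  foldr (fun k p => PTest (peq K0 k) ;; p) (paperiodic K0) (iota K0.+1 (N - K0)).

Lemma max_coord_pcopies K0 N : K0 < N -> max_coord (pcopies K0 N) <= N.
Proof.
move=> K0N; rewrite /pcopies.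
have : {in iota K0.+1 (N - K0), forall k, k <= N}.
  by move=> k; rewrite mem_iota; lia.
elim: (iota _ _) => /= [|k l IH] le; first by lia.
have := le k (mem_head _ _); have : {in l, forall k, k <= N}.
  by move=> k' k'l; apply: le; rewrite inE k'l orbT.
move=> /IH; lia.
Qed.

Definition zero_state : state := fun=> 0.

Lemma holds_paperiodic W K0 : holds W zero_state (paperiodic K0) <->
  forall a d, ~ forall i, W K0 (a + i) = W K0.+1 (a + d.+1 + i).
Proof.
rewrite /paperiodic; set p := PStar _ ;; _.
have -> : holds W zero_state (PNot p) <-> ~ holds W zero_state p.
  by split=> [[t [_ n]]//|n]; exists zero_state.
have kl : K0 != K0.+1 by lia.
have P a d : holds W (bump_coord (bump_coord (bump2 zero_state K0 K0.+1 a) K0.+1 1)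
      K0.+1 d) (peq K0 K0.+1) <-> forall i, W K0 (a + i) = W K0.+1 (a + d.+1 + i).
  rewrite /holds; set s := bump_coord _ _ _.
  have sE : s K0 = a /\ s K0.+1 = a + d.+1.
    by rewrite /s /zero_state; split; decide_coords; lia.
  split=> [[t /(run_peq_labels _ _ _ kl)[_]]|H]; first by case: sE => -> ->.
  by exists s; apply/run_peq_labels => //; case: sE => -> ->.
rewrite holds_star_inc2; split=> [H a d h|H [a]].
  apply: H; exists a; rewrite holds_inc holds_star_inc; exists d; exact/P.
by rewrite holds_inc holds_star_inc => -[d /P]; exact: H.
Qed.

(** At the origin [peq] compares whole paths. The hypotheses on [W] that make it compare positions
    are what is tested here, so only its reading on labels is available. *)
Lemma holds_pcopies W K0 N : holds W zero_state (pcopies K0 N) <->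
  (forall k i, K0 < k <= N -> W K0 i = W k i) /\
  forall a d, ~ forall i, W K0 (a + i) = W K0.+1 (a + d.+1 + i).
Proof.
rewrite /pcopies -holds_paperiodic.
have mem k : (k \in iota K0.+1 (N - K0)) = (K0 < k <= N) by rewrite mem_iota; lia.
transitivity ((forall k i, k \in iota K0.+1 (N - K0) -> W K0 i = W k i) /\
  holds W zero_state (paperiodic K0)); last first.
  by split=> -[H ?]; split=> // k i; [rewrite -mem|rewrite mem]; exact: H.
have : {in iota K0.+1 (N - K0), forall k, K0 != k}.
  by move=> k; rewrite mem_iota; lia.
elim: (iota _ _) => /= [|k l IH] ne; first by split=> // -[].
rewrite holds_test IH; last by move=> k' k'l; apply: ne; rewrite inE k'l orbT.
have kne := ne k (mem_head _ _).
split=> [[[t /(run_peq_labels _ _ _ kne)[_ H]] [Hl ha]]|[H ha]].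
  by split=> // k' i; rewrite inE => /orP[/eqP->|/Hl//]; exact: (H i).
split; last by split=> // k' i k'l; apply: H; rewrite inE k'l orbT.
exists zero_state; apply/run_peq_labels => //; split=> // i.
by apply: H; rewrite mem_head.
Qed.

(** * The reduction *)

Fixpoint matrix (th : so_form) : so_form :=
  match th with SExS _ th1 | SAllS _ th1 => matrix th1 | _ => th end.

Fixpoint num_sets (th : so_form) : nat :=
  match th with SExS _ th1 | SAllS _ th1 => (num_sets th1).+1 | _ => 0 end.

(** Paths are numbered by quantifier depth, as in [hform]; the update lets an inner binder shadow an
    outer one of the same name. *)
Fixpoint set_coord (th : so_form) n (C : nat -> nat) : nat -> nat :=
  match th with
  | SExS X th1 | SAllS X th1 => set_coord th1 n.+1 (env_update C X n)
  | _ => C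
  end.

Section Prefix.
Variable body : forall n, qf 'I_1 n.

(** A family of bodies over all arities avoids casts, since the final arity is [m + n] only up to a
    provable equation. *)
Fixpoint exists_many m n : hform 'I_1 n :=
  if m is m1.+1 then HExists (exists_many m1 n.+1) else HBody (body n).

Fixpoint prefix m (th : so_form) n : hform 'I_1 n :=
  match th with
  | SExS _ th1 => HExists (prefix m th1 n.+1)
  | SAllS _ th1 => HForall (prefix m th1 n.+1)
  | _ => exists_many m n
  end.

Lemma prefix_wf m th n : (forall n, qf_wf (body n)) -> hform_wf (prefix m th n).
Proof.
move=> wf; have em n1 : hform_wf (exists_many m n1) by elim: m n1 => /=.
by elim: th n => /=.
Qed.

Lemma prefix_preds_bound m th n : (forall n, qf_preds_in [::] (body n)) ->
  hform_preds_bound (prefix m th n).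
Proof.
move=> wf; have em n1 : hform_preds_bound (exists_many m n1) by elim: m n1 => /=.
by elim: th n => /=.
Qed.

End Prefix.

Lemma paths_of_ord (S : finType) (K : kripke 'I_1 S) n (p0 : path_of K)
  (Pi : assignment K n) (i : 'I_n) : paths_of p0 Pi i = Pi i.
Proof. by rewrite /paths_of valK. Qed.

Lemma paths_of_extend (S : finType) (K : kripke 'I_1 S) n (p0 p : path_of K)
    (Pi : assignment K n) k : k <= n ->
  paths_of p0 (extend Pi p) k = if k == n then p else paths_of p0 Pi k.
Proof.
move=> kn; rewrite {1}/paths_of; case: insubP => [u _ uk|/negP//].
rewrite ffunE; case: unliftP => [i ui|ui] /=; last first.
  by rewrite -uk ui /= eqxx.
have ki : k = i by rewrite -(lift_max i) -ui -uk.
by rewrite ki paths_of_ord (ltn_eqF (ltn_ord i)).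
Qed.

Lemma exists_many_sat (S : finType) (K : kripke 'I_1 S) (p0 : path_of K) body N m n
    (Pi : assignment K n) : m + n = N.+1 ->
  hform_sat (exists_many body m n) Pi <->
  exists Pi' : assignment K N.+1,
    (forall k, k < n -> paths_of p0 Pi' k = paths_of p0 Pi k) /\
    hform_sat (HBody (body N.+1)) Pi'.
Proof.
elim: m n Pi => [|m IH] n Pi.
  rewrite add0n => nN; subst n; split=> [h|[Pi' [agree]]]; first by exists Pi.
  suff -> : Pi' = Pi by [].
  by apply/ffunP => i; rewrite -!(paths_of_ord p0) agree.
rewrite addSn -addnS => nN; split=> /= [[p /(IH _ _ nN)[Pi' [agree h]]]|
  [Pi' [agree h]]].
  exists Pi'; split=> // k kn; rewrite agree; last exact: ltnW.
  by rewrite paths_of_extend ?(ltnW kn) // (ltn_eqF kn).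
exists (paths_of p0 Pi' n); apply/IH => //; exists Pi'; split=> // k.
rewrite ltnS => kn; rewrite paths_of_extend //; case: eqP => [->//|/eqP ne].
by rewrite agree // ltn_neqAle ne.
Qed.

(** The test [A] stays outside the block of [Next]: it must see the origin, whereas [p] starts with
    coordinate [k] at the input [u]. *)
Definition num_body A p k u (n : nat) : qf 'I_1 n :=
  if n is N.+1 then qf_and (compile N A) (iter u (Next (inord k)) (compile N p))
  else qf_true _ _.

Lemma iter_next_correct (S : finType) (K : kripke 'I_1 S) N p0 p k u
    (V : valuation K N.+1) Pi j : max_coord p <= N -> k <= N ->
  qf_sem V (iter u (Next (inord k)) (compile N p)) Pi j <->
  holds (labels_of (paths_of p0 Pi)) (bump_coord (state_of j) k u) p.
Proof.
move=> pN kN; elim: u j => [|u IH] j.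
  by rewrite bump_coord0; exact: compile_correct.
by rewrite /= IH state_of_shift // bump_coordD add1n.
Qed.

Lemma state_of0 n : @state_of n [ffun=> 0] = zero_state.
Proof.
by apply/funext => k; rewrite /state_of;
  case: (insub k : option 'I_n) => // i; rewrite ffunE.
Qed.

(** * Correctness of the reduction *)

Section Reduction.
Variables (th0 : so_form) (C0 : nat -> nat) (K0 u : nat).
Hypothesis ar0 : arithmetical th0.

Let p := pform C0 (fun=> K0) th0 K0.+1.
(** The bound [K0.+1] guarantees the second copy that [paperiodic] reads. *)
Let N := maxn K0.+1 (max_coord p).
Let body := num_body (pcopies K0 N) p K0 u.
Let p0 := bit_path (fun=> false).

Definition path_set (q : path_of bits) : set nat :=
  [set m | labels_of (fun=> q) 0 m.+1].

Let represents C (Xs : seq nat) (E : nat -> set nat) n (Pi : assignment bits n) :=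
  {in Xs, forall X, C X < n /\ E X = path_set (paths_of p0 Pi (C X))}.

(** Passing [pcopies] supplies the hypotheses under which [p] decides the matrix. The default path
    is that of [K0], so that coordinates beyond [N] are copies as well. *)
Lemma body_sat Xs E (Pi : assignment bits K0) (Pi' : assignment bits N.+1) :
  so_vars_in [:: 0] Xs th0 -> represents C0 Xs E Pi ->
  (forall k, k < K0 -> paths_of p0 Pi' k = paths_of p0 Pi k) ->
  let W := labels_of (paths_of (Pi' (inord K0)) Pi') in
  hform_sat (HBody (body N.+1)) Pi' <->
  holds W zero_state (pcopies K0 N) /\
  (holds W zero_state (pcopies K0 N) -> so_sat (fun=> u) E th0).
Proof.
move=> vars rep agree W.
have K0N : K0 < N by rewrite /N leq_max leqnn.
have pN : max_coord p <= N by rewrite /N leq_max leqnn orbT.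
have Wpaths k : k <= N -> paths_of (Pi' (inord K0)) Pi' k = paths_of p0 Pi' k.
  by rewrite /paths_of; case: insubP => // /negP.
have correct : holds W zero_state (pcopies K0 N) ->
    holds W (bump_coord zero_state K0 u) p <-> so_sat (fun=> u) E th0.
  move=> /holds_pcopies[copies aper].
  have W_const k i : K0 <= k -> W k i = W K0 i.
    rewrite leq_eqVlt => /orP[/eqP<-//|Kk].
    have [kN|Nk] := leqP k N; first by rewrite [RHS](copies k) ?Kk.
    rewrite /W /labels_of; congr (_ \in label _ (pos _ i)).
    rewrite /paths_of; case: insubP => [v|_]; first by rewrite ltnS leqNgt Nk.
    case: insubP => [v _ vK|]; last by rewrite ltnS (ltnW K0N).
    by congr (Pi' _); apply/val_inj; rewrite /= inordK // ltnS ltnW.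
  apply: (@holds_pform _ _ W_const _ _ _ _ _ [:: 0] Xs) => //.
  - move=> a b H; have [ab|ba|//] := ltngtP a b; exfalso.
      (* The predecessor appears because the tested offset is [d.+1]. *)
      apply: (aper a (b - a).-1) => i; rewrite W_const // H; congr (W _ _); lia.
    apply: (aper b (a - b).-1) => i; rewrite W_const // -H; congr (W _ _); lia.
  - move=> x _; rewrite leqnn ltnSn /bump_coord eqxx; by [].
  - by move=> i Ki; rewrite /bump_coord; case: eqP Ki => // ->; rewrite ltnn.
  - move=> X XXs; have [CK ->] := rep _ XXs; split=> //.
      by rewrite /bump_coord (ltn_eqF CK).
    move=> m; rewrite /path_set /W /labels_of /= Wpaths ?agree //; lia.
have E0 V : qf_sem V (body N.+1) Pi' [ffun=> 0] <->
    holds W zero_state (pcopies K0 N) /\ holds W (bump_coord zero_state K0 u) p.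
  rewrite qf_sem_and (@compile_correct _ _ _ (Pi' (inord K0))) ?max_coord_pcopies //.
  by rewrite (@iter_next_correct _ _ _ (Pi' (inord K0))) ?(ltnW K0N) // state_of0.
split=> [[V /E0[hc hp]]|[hc sat]]; first by split=> // _; apply/correct.
exists (fun _ _ => classical_sets.set0); apply/E0; split=> //.
by apply/correct => //; exact: sat.
Qed.

(** Any choice of number paths that passes the test yields the truth value of the matrix, and the
    powers of 2 give one such choice. *)
Lemma exists_body_sat Xs E (Pi : assignment bits K0) :
  so_vars_in [:: 0] Xs th0 -> represents C0 Xs E Pi ->
  hform_sat (exists_many body (N.+1 - K0) K0) Pi <-> so_sat (fun=> u) E th0.
Proof.
move=> vars rep.
have K0N : K0 < N by rewrite /N leq_max leqnn.
rewrite (@exists_many_sat _ _ p0 body N) ?subnK //; last by lia.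
split=> [[Pi' [agree /(body_sat vars rep agree)[hc sat]]]|sat]; first exact: sat.
pose q := bit_path is_pow2.
pose Pi' : assignment bits N.+1 :=
  [ffun i : 'I_N.+1 => if i < K0 then paths_of p0 Pi i else q].
have PiE d k : k <= N -> paths_of d Pi' k = if k < K0 then paths_of p0 Pi k else q.
  rewrite {1}/paths_of; case: insubP => [v _ vk|/negP//] _.
  by rewrite ffunE -vk.
have agree k : k < K0 -> paths_of p0 Pi' k = paths_of p0 Pi k.
  by move=> kK; rewrite PiE ?kK //; lia.
exists Pi'; split=> //; apply/(body_sat vars rep agree); split=> //.
have WE k i : K0 <= k <= N ->
    labels_of (paths_of (Pi' (inord K0)) Pi') k i = (i != 0) && is_pow2 i.
  move=> /andP[Kk kN]; apply: labels_of_bit_path.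
  by rewrite PiE // ltnNge Kk.
apply/holds_pcopies; split=> [k i kK|a d H].
  by rewrite !WE; lia.
have : a = a + d.+1 by apply: is_pow2_aperiodic => i; rewrite -!(WE K0.+1) -?H ?WE; lia.
lia.
Qed.

Lemma prefix_sat Xs E th n C (Pi : assignment bits n) :
  matrix th = th0 -> set_coord th n C = C0 -> num_sets th + n = K0 ->
  so_vars_in [:: 0] Xs th -> represents C Xs E Pi ->
  hform_sat (prefix body (N.+1 - K0) th n) Pi <-> so_sat (fun=> u) E th.
Proof.
have repE n1 C1 Xs1 E1 (Pi1 : assignment bits n1) X q :
    represents C1 Xs1 E1 Pi1 ->
    represents (env_update C1 X n1) (X :: Xs1) (env_update E1 X (path_set q))
      (extend Pi1 q).
  move=> rep Y; rewrite inE /env_update; case: eqP => [_ _|_ /= /rep[Cn ->]].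
    by rewrite ltnSn paths_of_extend // eqxx.
  by rewrite ltnS (ltnW Cn) paths_of_extend ?(ltnW Cn) // (ltn_eqF Cn).
(* Every set comes from a path; [m.-1] undoes the delay by one position. *)
have setE (U : set nat) : path_set (bit_path (fun m => `[< U m.-1 >])) = U.
  apply/seteqP; split=> m; rewrite /path_set /= (labels_of_bit_path _ (erefl _)) //=.
    by move/asboolP.
  by move=> Um; apply/asboolP.
(* All constructors other than set quantifiers end the prefix; equations keep the parameters free
   for the induction. *)
have base th1 n1 C1 Xs1 E1 (Pi1 : assignment bits n1) :
    th1 = th0 -> C1 = C0 -> n1 = K0 -> so_vars_in [:: 0] Xs1 th1 ->
    represents C1 Xs1 E1 Pi1 ->
    hform_sat (exists_many body (N.+1 - K0) n1) Pi1 <-> so_sat (fun=> u) E1 th1.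
  by move=> thE CE nE; subst th1 C1 n1; exact: exists_body_sat.
elim: th Xs E n C Pi => [??|??|??|??|????|????|???|???|X th IH|X th IH] Xs E n C Pi
  thE CE nE vars rep; try exact: (base _ _ _ _ _ _ thE CE nE vars rep).
- have {}IH q := IH (X :: Xs) (env_update E X (path_set q)) n.+1 (env_update C X n)
    (extend Pi q) thE CE (etrans (addnS _ _) nE) vars (repE _ _ _ _ _ X q rep).
  split=> /= [[q /IH h]|[U h]].
    by exists (path_set q).
  by exists (bit_path (fun m => `[< U m.-1 >])); apply/IH; rewrite setE.
- have {}IH q := IH (X :: Xs) (env_update E X (path_set q)) n.+1 (env_update C X n)
    (extend Pi q) thE CE (etrans (addnS _ _) nE) vars (repE _ _ _ _ _ X q rep).
  split=> /= [h U|h q].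
    by have := h (bit_path (fun m => `[< U m.-1 >])); rewrite IH setE.
  exact/IH.
Qed.

End Reduction.


(** * Computability *)

Lemma computable1_comp f g : computable1 f -> computable1 g -> computable1 (f \o g).
Proof.
move=> cf cg; pose gs (_ : 'I_1) (v : 1.-tuple nat) := g (thead v).
apply: computable_ext (@computable_comp 1 1 _ gs cf _) => // v.
by rewrite /gs /thead tnth_mktuple.
Qed.

Lemma computable1_iter h q : computable1 h -> computable1 (fun n => iter n h q).
Proof.
move=> ch; have cq : computable (fun _ : 0.-tuple nat => q).
  elim: q => [|q IH]; first exact: computable_zero.
  pose gs (_ : 'I_1) (_ : 0.-tuple nat) := q.
  apply: computable_ext (@computable_comp 1 0 _ gs computable_succ _) => // v.
  by rewrite /gs /thead tnth_mktuple.
(* Entry 1 is the accumulated value; entry 0 is the round counter. *)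
pose gs (_ : 'I_1) (v : 2.-tuple nat) := tnth v (lift ord0 ord0).
have cg : @computable 2 (fun v : 2.-tuple nat => h (tnth v (lift ord0 ord0))).
  apply: computable_ext (@computable_comp 1 2 _ gs ch _) => [v|i].
    by rewrite /gs /thead tnth_mktuple.
  exact: computable_proj.
apply: computable_ext (computable_primrec cq cg) => v /=.
by elim: (thead v) => //= n <-; rewrite (tnth_nth 0).
Qed.

Lemma computable1_ext f g : f =1 g -> computable1 f -> computable1 g.
Proof. by move=> fg; apply: computable_ext => v; rewrite fg. Qed.

Lemma computable1_affine a b : computable1 (fun n => a * n + b).
Proof.
have cS : computable1 succn := computable_succ.
have ca : computable1 (fun n => a + n).
  elim: a => [|a IH]; last exact: (computable1_comp cS IH).
  by apply: computable_ext (computable_proj ord0).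
apply: computable1_ext (computable1_iter b ca) => n.
by elim: n => [|n IH]; rewrite ?muln0 // iterS IH mulnS addnA.
Qed.

(** A singleton has code [2 ^ n], and prepending a constant [c] sends a code [m] to
    [2 ^ c * (2 * m + 1)], which is affine in [m]. The varying entry therefore comes last. *)
Lemma computable1_code s : computable1 (fun n => CodeSeq.code (rcons s n)).
Proof.
elim: s => [|c s IH].
  apply: computable1_ext (computable1_iter 1 (computable1_affine 2 0)) => n.
  rewrite /CodeSeq.code /= muln1; elim: n => [|n IH]; first by [].
  by rewrite iterS IH addn0 -expnS.
apply: computable1_ext (computable1_comp (computable1_affine (2 * 2 ^ c) (2 ^ c)) IH) => n.
rewrite /CodeSeq.code /=; set m := foldr _ _ _.
by rewrite -muln2; lia.
Qed.

Lemma code_rcons_inj s : injective (fun n => CodeSeq.code (rcons s n)).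
Proof. by move=> m n /(can_inj CodeSeq.codeK) /rcons_inj[]. Qed.

(** This makes codes grow strictly with each [Next], so that the input can be recovered from the
    length of the block. *)
Lemma ltn_code_rcons s n : n < CodeSeq.code (rcons s n).
Proof.
elim: s => [|c s IH]; first by rewrite /CodeSeq.code /= muln1 ltn_expl.
rewrite /CodeSeq.code /=; move: IH; rewrite /CodeSeq.code; set m := foldr _ _ _ => IH.
have := expn_gt0 2 c; move: (2 ^ c) => [//|k] _.
by rewrite mulSn -muln2; lia.
Qed.

Lemma iter_inj h q : (forall n, n < h n) -> injective (fun n => iter n h q).
Proof.
move=> lth; have lt m n : m < n -> iter m h q < iter n h q.
  elim: n => // n IH; rewrite ltnS leq_eqVlt => /orP[/eqP->|/IH mn]; first exact: lth.
  exact: ltn_trans mn (lth _).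
by move=> m n /= E; have [/lt|/lt|//] := ltngtP m n; rewrite E ltnn.
Qed.

Definition computable_injection g := computable1 g /\ injective g.

Lemma computable_injection_comp f g : computable_injection f ->
  computable_injection g -> computable_injection (f \o g).
Proof.
by move=> [cf fi] [cg gi]; split; [exact: computable1_comp|exact: inj_comp].
Qed.

Lemma computable_injection_code s :
  computable_injection (fun n => CodeSeq.code (rcons s n)).
Proof. by split; [exact: computable1_code|exact: code_rcons_inj]. Qed.

(** The quantifier prefix does not depend on the input, so one map [g], chosen before [body], serves
    all inputs. *)
Lemma computable_injection_prefix m th n : exists g, computable_injection g /\ forall body,
  code_hform (prefix body m th n) = g (code_qf (body (m + num_sets th + n))).
Proof.
have many m1 n1 : exists g, computable_injection g /\ forall body,
    code_hform (exists_many body m1 n1) = g (code_qf (body (m1 + 0 + n1))).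
  elim: m1 n1 => [|m1 IH] n1; first by eexists; split;
    first exact: (computable_injection_code [:: 2]).
  have [g [gg E]] := IH n1.+1.
  exists ((fun x => CodeSeq.code (rcons [:: 0] x)) \o g).
  split; first by apply: computable_injection_comp => //; exact: computable_injection_code.
  by move=> body /=; rewrite E addnS !addSn.
elim: th n => //= _ th IH n; have [g [gg E]] := IH n.+1.
- exists ((fun x => CodeSeq.code (rcons [:: 0] x)) \o g).
  split; first by apply: computable_injection_comp => //; exact: computable_injection_code.
  by move=> body /=; rewrite E !addnS !addSn.
- exists ((fun x => CodeSeq.code (rcons [:: 1] x)) \o g).
  split; first by apply: computable_injection_comp => //; exact: computable_injection_code.
  by move=> body /=; rewrite E !addnS !addSn.
Qed.

Lemma computable_injection_num_body A p k N :
  computable_injection (fun u => code_qf (num_body A p k u N.+1)).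
Proof.
pose next := fun q => CodeSeq.code (rcons [:: 2; nat_of_ord (inord k : 'I_N.+1)] q).
have iterE u : code_qf (iter u (Next (inord k)) (compile N p)) =
    iter u next (code_qf (compile N p)).
  by elim: u => //= u ->.
pose neg := fun q => CodeSeq.code (rcons [:: 4] q).
pose or := fun q => CodeSeq.code (rcons [:: 3; neg (code_qf (compile N A))] q).
have -> : (fun u => code_qf (num_body A p k u N.+1)) =
    neg \o (or \o (neg \o (fun u => iter u next (code_qf (compile N p))))).
  by apply/funext => u /=; rewrite -iterE.
do 3![apply: computable_injection_comp; first exact: computable_injection_code].
split; first exact/computable1_iter/computable1_code.
by apply: iter_inj => n; exact: ltn_code_rcons.
Qed.

Theorem theorem5p3 : Sigma12_hard model_checking.
Proof.
move=> A [th [S12 vars AE]].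
pose K0 := num_sets th; pose C0 := set_coord th 0 id.
pose p := pform C0 (fun=> K0) (matrix th) K0.+1.
pose N := maxn K0.+1 (max_coord p).
pose body u := num_body (pcopies K0 N) p K0 u.
pose phi u := prefix (body u) (N.+1 - K0) th 0.
have ar : arithmetical (matrix th).
  (* Past the existential block only [is_Pi11] is known, hence the nested induction. *)
  elim: (th) S12 => //= X th1 _; by elim: th1.
exists (fun u => code_instance bits (phi u)).
have [g [gg gE]] := computable_injection_prefix (N.+1 - K0) th 0.
have Nsum : N.+1 - K0 + num_sets th + 0 = N.+1.
  by rewrite addn0 subnK // /N; lia.
have phiE u : code_hform (phi u) = g (code_qf (body u N.+1)) by rewrite /phi gE Nsum.
have [c i] : computable_injection (fun u => code_instance bits (phi u)).
  have -> : (fun u => code_instance bits (phi u)) =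
      (fun x => CodeSeq.code (rcons [:: code_kripke bits] x)) \o
      (g \o (fun u => code_qf (body u N.+1))).
    by apply/funext => u; rewrite /code_instance phiE.
  apply: computable_injection_comp; first exact: computable_injection_code.
  by apply: computable_injection_comp => //; exact: computable_injection_num_body.
have body_wf u n : qf_wf (body u n).
  case: n => //= n; rewrite (dia_wf (d := 0)) //=.
  by elim: u => //= *; exact: dia_wf.
have body_closed u n : qf_preds_in [::] (body u n).
  case: n => //= n; rewrite dia_preds_in //=.
  by elim: u => //= *; exact: dia_preds_in.
split=> // u; rewrite AE.
have sat : models bits (phi u) <-> so_sat (fun=> u) (fun=> classical_sets.set0) th.
  apply: (@prefix_sat _ C0 K0 u ar [::]) => //; exact: addn0.
rewrite -sat.
split=> [h|[k [m [K [phi' [wf cl E h]]]]]].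
  exists 1, 2, bits, (phi u); split=> //; [exact: prefix_wf|exact: prefix_preds_bound].
(* The sizes are identified first, because the types of the structure and the formula depend on
   them. *)
have [k1 m2] := code_instance_sizes_inj E; subst k m.
by have [-> ->] := code_instance_inj E.
Qed.
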